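(* Let $\delta:\mathbb{N}\to\mathbb{N}$ be a sequence of positive integers, let $\mathcal{F}=\mathcal{F}^\delta$ be the algebra of matrix sequences with dimension function $\delta$, and let $\mathcal{A}$ be a unital $C^*$-subalgebra of $\mathcal{F}$ (i.e. containing the identity sequence). Then $\mathcal{A}$ is essentially fractal if and only if every self-adjoint sequence in $\mathcal{A}$ has Arveson dichotomy.
   Context: $\mathcal{F}=\mathcal{F}^\delta$ is the $C^*$-algebra of all bounded sequences $(A_n)$ of matrices $A_n\in\mathbb{C}^{\delta(n)\times\delta(n)}$ (pointwise operations, supremum norm). The ideal $\mathcal{K}$ of compact sequences is the smallest closed ideal of $\mathcal{F}$ containing all sequences $(K_n)\in\mathcal{F}$ with $\operatorname{rank}K_n\le 1$ for all $n$; equivalently, $(A_n)\in\mathcal{K}$ iff for every $\varepsilon>0$ there is $(K_n)\in\mathcal{F}$ with $\sup_n\|A_n-K_n\|<\varepsilon$ and $\sup_n\operatorname{rank}K_n<\infty$. For a strictly increasing $\eta:\mathbb{N}\to\mathbb{N}$, let $R_\eta:(A_n)\mapsto(A_{\eta(n)})$ be the restriction map from $\mathcal{F}^\delta$ onto $\mathcal{F}_\eta:=\mathcal{F}^{\delta\circ\eta}$, and for $\mathcal{B}\subseteq\mathcal{F}$ write $\mathcal{B}_\eta:=R_\eta(\mathcal{B})$. ($\mathcal{K}_\eta$ is the ideal of compact sequences of $\mathcal{F}_\eta$.) A $^*$-homomorphism $W:\mathcal{A}\to\mathcal{B}$ on a $C^*$-subalgebra $\mathcal{A}$ of $\mathcal{F}$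 is fractal if for every strictly increasing $\eta$ there is a mapping $W_\eta:\mathcal{A}_\eta\to\mathcal{B}$ with $W=W_\eta R_\eta|_{\mathcal{A}}$. A $C^*$-subalgebra $\mathcal{A}$ of $\mathcal{F}$ is essentially fractal if the canonical homomorphism $\mathcal{A}\to\mathcal{A}/(\mathcal{A}\cap\mathcal{K})$ is fractal and $(\mathcal{A}\cap\mathcal{K})_\eta=\mathcal{A}_\eta\cap\mathcal{K}_\eta$ for every strictly increasing $\eta$. For a self-adjoint matrix $A$ and $M\subseteq\mathbb{R}$, $N(A,M)$ denotes the number of eigenvalues of $A$ in $M$, counted with multiplicity. For a self-adjoint sequence $(A_n)\in\mathcal{F}$, a point $\lambda\in\mathbb{R}$ is essential if $\lim_{n\to\infty}N(A_n,U)=\infty$ for every open interval $U$ containing $\lambda$; it is transient if there is an open interval $U$ containing $\lambda$ with $\sup_{n}N(A_n,U)<\infty$. A self-adjoint sequence has Arveson dichotomy if every real number is either essential or transient for it. *)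

(* Defs.v *)
From mathcomp Require Import all_boot all_order all_algebra.
From mathcomp Require Import complex.
From mathcomp Require Import all_classical all_reals all_analysis.

Set Implicit Arguments.
Unset Strict Implicit.
Unset Printing Implicit Defensive.

Import Order.TTheory GRing.Theory Num.Theory.
Import numFieldNormedType.Exports.

Local Open Scope classical_set_scope.
Local Open Scope complex_scope.
Local Open Scope sesquilinear_scope.
Local Open Scope ring_scope.

Section Matrices.
Variable R : realType.

Definition l2norm (m : nat) (v : 'cV[R[i]]_m) : R :=
  Num.sqrt (\sum_(j < m) Normc.normc (v j 0) ^+ 2).

Definition opnorm (m : nat) (A : 'M[R[i]]_m) : R :=
  sup [set l2norm (A *m v) | v in [set v : 'cV[R[i]]_m | l2norm v <= 1]].

(* The roots of the characteristic polynomial, repeated according to their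
   (algebraic = geometric, in the self-adjoint case) multiplicity. *)
Definition eigenvalues (m : nat) (A : 'M[R[i]]_m) : seq R[i] :=
  sval (closed_field_poly_normal (char_poly A)).

Definition N (m : nat) (A : 'M[R[i]]_m) (M : set R) : nat :=
  count (fun z => `[< exists2 x : R, M x & z = x%:C >]) (eigenvalues A).

End Matrices.

Section MatrixSequences.
Variable R : realType.

Definition mxseq (delta : nat -> nat) : Type :=
  forall n, 'M[R[i]]_(delta n).

Section Algebra.
Variable delta : nat -> nat.
Implicit Types (A B K : mxseq delta) (S J : set (mxseq delta)).

Definition seq1 : mxseq delta := fun n => 1%:M.
Definition seq0 : mxseq delta := fun n => 0.
Definition seqadd A B : mxseq delta := fun n => A n + B n.
Definition seqsub A B : mxseq delta := fun n => A n - B n.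
Definition seqscale (c : R[i]) A : mxseq delta := fun n => c *: A n.
Definition seqmul A B : mxseq delta := fun n => A n *m B n.
Definition seqadj A : mxseq delta := fun n => (A n)^t*.

Definition supnorm A : R := sup [set opnorm (A n) | n in [set: nat]].

Definition F : set (mxseq delta) :=
  [set A | exists M : R, forall n, opnorm (A n) <= M].

Definition norm_closed S : Prop :=
  forall A, F A ->
    (forall e : R, 0 < e -> exists2 B, S B & supnorm (seqsub A B) < e) -> S A.

Record cstar_subalgebra S : Prop := CstarSubalgebra {
  csub_bounded : S `<=` F;
  csub0 : S seq0;
  csubD : forall A B, S A -> S B -> S (seqadd A B);
  csubZ : forall c A, S A -> S (seqscale c A);
  csubM : forall A B, S A -> S B -> S (seqmul A B);
  csub_adj : forall A, S A -> S (seqadj A);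
  csub_closed : norm_closed S
}.

(* Stability under scalars follows from the multiplicative clauses, since F
   contains the scalar multiples of the identity. *)
Record closed_ideal J : Prop := ClosedIdeal {
  cideal_bounded : J `<=` F;
  cideal0 : J seq0;
  cidealD : forall A B, J A -> J B -> J (seqadd A B);
  cidealMl : forall A B, F A -> J B -> J (seqmul A B);
  cidealMr : forall A B, J A -> F B -> J (seqmul A B);
  cideal_closed : norm_closed J
}.

Definition compact_seqs : set (mxseq delta) :=
  smallest closed_ideal [set K | F K /\ forall n, (\rank (K n) <= 1)%N].

(* The canonical map onto the quotient by J, whose elements are the cosets
   A + J. *)
Definition coset_map J A : set (mxseq delta) := [set seqadd A K | K in J].

Definition selfadjoint A : Prop := seqadj A = A.

Definition open_interval_at (x : R) (U : set R) : Prop :=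
  [/\ open U, is_interval U & U x].

Definition essential A (x : R) : Prop :=
  forall U, open_interval_at x U -> N (A n) U @[n --> \oo] --> \oo.

Definition transient A (x : R) : Prop :=
  exists2 U, open_interval_at x U & exists M, forall n, (N (A n) U <= M)%N.

Definition arveson_dichotomy A : Prop :=
  forall x : R, essential A x \/ transient A x.

End Algebra.

Definition strictly_increasing (eta : nat -> nat) : Prop :=
  {homo eta : m n / (m < n)%N}.

Definition restr (delta eta : nat -> nat) (A : mxseq delta) :
  mxseq (delta \o eta) := fun n => A (eta n).

(* Only the values of W on S and of W_eta on the restriction of S matter;
   the maps are total for convenience. *)
Definition fractal (delta : nat -> nat) (S : set (mxseq delta)) (T : Type)
    (W : mxseq delta -> T) : Prop :=
  forall eta, strictly_increasing eta ->
    exists W_eta : mxseq (delta \o eta) -> T,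
      forall A, S A -> W A = W_eta (restr eta A).

Definition essentially_fractal (delta : nat -> nat) (S : set (mxseq delta)) :
    Prop :=
  fractal S (coset_map (S `&` @compact_seqs delta)) /\
  forall eta, strictly_increasing eta ->
    restr eta @` (S `&` @compact_seqs delta) =
    (restr eta @` S) `&` (restr eta @` @compact_seqs delta).

End MatrixSequences.

(* Main.v *)
(* Essential fractality of S means: if A in S agrees with some compact sequence
   along a subsequence, then A is compact. Moreover, a self-adjoint sequence is
   compact iff, for each eps > 0, the number of its eigenvalues outside
   ]-eps, eps[ stays bounded.

   If S is essentially fractal and x is not essential for A, then along some
   subsequence A has boundedly many eigenvalues in an interval around x; a bump
   function of A supported there lies in S and has bounded rank along that
   subsequence, hence is compact, and so x is transient.

   Conversely, let A in S be compact along a subsequence, and let B = A^* A. No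
   y > 0 is essential for B, so all are transient, and by compactness of
   [eps, sup |B_n|] the number of eigenvalues of B_n above eps is bounded. If
   P_n is the corresponding spectral projection, then |A_n - A_n P_n|^2 <= eps,
   so A is a limit of sequences of bounded rank. *)
Require Import Defs.
From mathcomp Require Import all_boot all_order all_algebra.
From mathcomp Require Import complex.
From mathcomp Require Import all_classical all_reals all_analysis.
From mathcomp Require Import lra.

Set Implicit Arguments.
Unset Strict Implicit.
Unset Printing Implicit Defensive.

Import Order.TTheory GRing.Theory Num.Theory.
Import numFieldNormedType.Exports.

Local Open Scope classical_set_scope.
Local Open Scope complex_scope.
Local Open Scope sesquilinear_scope.
Local Open Scope ring_scope.

(** * Euclidean norm and operator norm *)

Section OperatorNorm.
Variable R : realType.

Section Fixed.
Variable m : nat.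
Implicit Types (u v : 'cV[R[i]]_m) (A B : 'M[R[i]]_m).

Lemma l2norm_ge0 v : 0 <= l2norm v.
Proof. exact: sqrtr_ge0. Qed.

Lemma le_l2norm v (M : R) : 0 <= M ->
  (M <= l2norm v) = (M ^+ 2 <= l2norm v ^+ 2).
Proof. by move=> M0; rewrite ler_pXn2r ?nnegrE ?l2norm_ge0. Qed.

Lemma l2norm_le v (M : R) : 0 <= M ->
  (l2norm v <= M) = (l2norm v ^+ 2 <= M ^+ 2).
Proof. by move=> M0; rewrite ler_pXn2r ?nnegrE ?l2norm_ge0. Qed.

Lemma sqr_l2norm v : l2norm v ^+ 2 = \sum_(j < m) Normc.normc (v j 0) ^+ 2.
Proof. by rewrite sqr_sqrtr// sumr_ge0// => j _; rewrite sqr_ge0. Qed.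

Lemma sqr_l2normE v : (l2norm v ^+ 2)%:C = (v^t* *m v) 0 0.
Proof.
rewrite sqr_l2norm rmorph_sum mxE; apply: eq_bigr => j _.
by rewrite rmorphXn !mxE mulrC -normCK normc_def; case: (v j 0).
Qed.

Lemma l2norm_dotmx v : (l2norm v)%:C = sqrtC (dotmx v^T v^T).
Proof.
rewrite -[LHS]sqrCK ?ler0c ?l2norm_ge0// -rmorphXn/= sqr_l2normE dotmxE.
congr sqrtC; rewrite !mxE; apply: eq_bigr => j _.
by rewrite !mxE mulrC.
Qed.

Lemma l2normD u v : l2norm (u + v) <= l2norm u + l2norm v.
Proof.
rewrite -lecR rmorphD/= !l2norm_dotmx linearD/=.
exact: (triangle_lerif _ u^T v^T).1.
Qed.

Lemma l2normZ c v : l2norm (c *: v) = Normc.normc c * l2norm v.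
Proof.
have c0 : 0 <= Normc.normc c by case: c => a b; rewrite sqrtr_ge0.
apply/eqP; rewrite -(@eqrXn2 _ 2) ?mulr_ge0 ?l2norm_ge0//.
rewrite exprMn !sqr_l2norm mulr_sumr; apply/eqP/eq_bigr => j _.
by rewrite mxE Normc.normcM exprMn.
Qed.

Lemma l2norm0 : l2norm (0 : 'cV[R[i]]_m) = 0.
Proof. by rewrite -(scale0r 0) l2normZ Normc.normc0 mul0r. Qed.

Lemma l2normN v : l2norm (- v) = l2norm v.
Proof. by rewrite -scaleN1r l2normZ normcN Normc.normc1 mul1r. Qed.

Lemma normc_le_l2norm v j : Normc.normc (v j 0) <= l2norm v.
Proof.
have c0 : 0 <= Normc.normc (v j 0) by case: (v j 0) => a b; rewrite sqrtr_ge0.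
rewrite le_l2norm// sqr_l2norm (bigD1 j)//= lerDl.
by rewrite sumr_ge0// => k _; rewrite sqr_ge0.
Qed.

Lemma l2norm_gt0 v : v != 0 -> 0 < l2norm v.
Proof.
move=> v0; rewrite lt_neqAle l2norm_ge0 andbT eq_sym.
apply: contra_neq v0 => v0; apply/matrixP => j k; rewrite ord1 mxE.
apply: Normc.eq0_normc; apply/eqP; rewrite eq_le -{1}v0 normc_le_l2norm.
by case: (v j 0) => a b; rewrite sqrtr_ge0.
Qed.

(** [sup] is meaningful only for a nonempty set bounded above. A vector of norm at most 1 has
    entries of modulus at most 1, so the sum of the column norms is a bound. *)
Lemma has_sup_opnorm A :
  has_sup [set l2norm (A *m v) | v in [set v : 'cV[R[i]]_m | l2norm v <= 1]].
Proof.
split; first by exists (l2norm (A *m 0)), 0 => //=; rewrite l2norm0.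
exists (\sum_j l2norm (col j A)) => _ [v /= v1 <-].
have -> : A *m v = \sum_j v j 0 *: col j A.
  apply/matrixP => i k; rewrite ord1 summxE mxE; apply: eq_bigr => j _.
  by rewrite !mxE mulrC.
apply: (@le_trans _ _ (\sum_j l2norm (v j 0 *: col j A))).
  elim/big_ind2: _ => [|x1 x2 y1 y2 h1 h2|//]; first by rewrite l2norm0.
  by rewrite (le_trans (l2normD _ _))// lerD.
apply: ler_sum => j _; rewrite l2normZ ler_piMl ?l2norm_ge0//.
exact: le_trans (normc_le_l2norm v j) v1.
Qed.

Lemma l2norm_mulmx A v : l2norm (A *m v) <= opnorm A * l2norm v.
Proof.
have [->|v0] := eqVneq v 0; first by rewrite mulmx0 l2norm0 mulr0.
have n0 := l2norm_gt0 v0; rewrite -ler_pdivrMr//.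
have nV : Normc.normc (l2norm v)^-1%:C = (l2norm v)^-1.
  by rewrite /Normc.normc /= expr0n addr0 sqrtr_sqr ger0_norm ?invr_ge0 ?ltW.
have -> : l2norm (A *m v) / l2norm v = l2norm (A *m ((l2norm v)^-1%:C *: v)).
  by rewrite -scalemxAr l2normZ mulrC nV.
apply: ub_le_sup; first exact: (has_sup_opnorm A).2.
by exists ((l2norm v)^-1%:C *: v) => //=; rewrite l2normZ nV mulVf// gt_eqF.
Qed.

Lemma opnorm_le A M : 0 <= M ->
  (forall v, l2norm (A *m v) <= M * l2norm v) -> opnorm A <= M.
Proof.
move=> M0 AM; apply: ge_sup; first exact: (has_sup_opnorm A).1.
by move=> _ [v /= v1 <-]; rewrite (le_trans (AM v))// ler_piMr.
Qed.

Lemma opnorm_ge0 A : 0 <= opnorm A.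
Proof.
apply: le_trans (l2norm_ge0 (A *m 0)) _.
apply: ub_le_sup; first exact: (has_sup_opnorm A).2.
by exists 0 => //=; rewrite l2norm0.
Qed.

Lemma opnormD A B : opnorm (A + B) <= opnorm A + opnorm B.
Proof.
apply: opnorm_le => [|v]; first by rewrite addr_ge0 ?opnorm_ge0.
by rewrite mulmxDl mulrDl (le_trans (l2normD _ _))// lerD ?l2norm_mulmx.
Qed.

Lemma opnormM A B : opnorm (A *m B) <= opnorm A * opnorm B.
Proof.
apply: opnorm_le => [|v]; first by rewrite mulr_ge0 ?opnorm_ge0.
rewrite -mulmxA (le_trans (l2norm_mulmx _ _))// -mulrA ler_wpM2l ?opnorm_ge0//.
exact: l2norm_mulmx.
Qed.

Lemma opnormN A : opnorm (- A) = opnorm A.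
Proof. by congr sup; apply: eq_imagel => v _; rewrite mulNmx l2normN. Qed.

Lemma opnorm0 : opnorm (0 : 'M[R[i]]_m) = 0.
Proof.
apply/eqP; rewrite eq_le opnorm_ge0 andbT opnorm_le// => v.
by rewrite mul0mx l2norm0 mul0r.
Qed.

Lemma l2norm_unitary (U : 'M[R[i]]_m) v :
  U \is unitarymx -> l2norm (U *m v) = l2norm v.
Proof.
move=> UU; apply/eqP; rewrite -(@eqrXn2 _ 2) ?l2norm_ge0//; apply/eqP/complexI.
by rewrite !sqr_l2normE trmx_mul map_mxM/= mulmxA mulmxKtV.
Qed.

End Fixed.
End OperatorNorm.

(** * Unitarily diagonalized matrices: norms, ranks and eigenvalue counts *)

Section UnitaryDiagonal.
Variables (R : realType) (m : nat).
Implicit Types (U : 'M[R[i]]_m) (d e : 'I_m -> R).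

(** For fixed [U], functional calculus is pointwise: if A is [udiag U d], then f(A) is
    [udiag U (f \o d)]. *)
Definition udiag U d : 'M[R[i]]_m :=
  U^t* *m diag_mx (\row_j (d j)%:C) *m U.

Local Notation D d := (diag_mx (\row_(j < m) (d j)%:C)).

Lemma udiagD U d e : udiag U d + udiag U e = udiag U (fun j => d j + e j).
Proof.
have h : D d + D e = D (fun j => d j + e j).
  by apply/matrixP => i j; rewrite !mxE -mulrnDl -rmorphD.
by rewrite /udiag -h mulmxDr mulmxDl.
Qed.

Lemma udiagZ U c d : c%:C *: udiag U d = udiag U (fun j => c * d j).
Proof.
have h : c%:C *: D d = D (fun j => c * d j).
  by apply/matrixP => i j; rewrite !mxE mulrnAr -rmorphM.
by rewrite /udiag -h -scalemxAr -scalemxAl.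
Qed.

Lemma udiagM U d e : U \is unitarymx ->
  udiag U d *m udiag U e = udiag U (fun j => d j * e j).
Proof.
move=> UU; have h : D d *m D e = D (fun j => d j * e j).
  rewrite mulmx_diag; apply/matrixP => i j; rewrite !mxE.
  by rewrite -rmorphM.
by rewrite /udiag -h !mulmxA mulmxtVK.
Qed.

Lemma udiag1 U : U \is unitarymx -> udiag U (fun=> 1) = 1%:M.
Proof.
move=> UU; have h : D (fun=> 1 : R) = 1%:M.
  by apply/matrixP => i j; rewrite !mxE.
by rewrite /udiag h mulmx1 -[LHS]mul1mx mulmxA mulmxKtV.
Qed.

Lemma l2norm_udiag U d (v : 'cV_m) : U \is unitarymx ->
  l2norm (udiag U d *m v) ^+ 2 =
  \sum_j d j ^+ 2 * Normc.normc ((U *m v) j 0) ^+ 2.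
Proof.
move=> UU; rewrite /udiag -!mulmxA l2norm_unitary ?trmxC_unitary//.
rewrite sqr_l2norm; apply: eq_bigr => j _; rewrite mul_diag_mx !mxE.
rewrite Normc.normcM exprMn; congr (_ * _).
by rewrite /Normc.normc /= expr0n addr0 sqr_sqrtr ?sqr_ge0.
Qed.

Lemma opnorm_udiag_le U d M : U \is unitarymx -> 0 <= M ->
  (forall j, `|d j| <= M) -> opnorm (udiag U d) <= M.
Proof.
move=> UU M0 dM; apply: opnorm_le => // v.
rewrite l2norm_le ?mulr_ge0 ?l2norm_ge0// l2norm_udiag// exprMn.
rewrite -(l2norm_unitary v UU) sqr_l2norm mulr_sumr ler_sum// => j _.
by rewrite ler_wpM2r ?sqr_ge0// -real_normK ?num_real// lerXn2r ?nnegrE.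
Qed.

Lemma le_opnorm_udiag U d j : U \is unitarymx -> `|d j| <= opnorm (udiag U d).
Proof.
(* The unit eigenvector for [d j]. *)
move=> UU; pose v : 'cV[R[i]]_m := U^t* *m delta_mx j 0.
have v1 : U *m v = delta_mx j 0 by rewrite mulmxA (unitarymxP _) ?mul1mx.
have nv : l2norm v ^+ 2 = 1.
  rewrite -(l2norm_unitary v UU) v1 sqr_l2norm (bigD1 j)//= big1 ?addr0.
    by rewrite mxE !eqxx Normc.normc1 expr1n.
  by move=> k /negPf kj; rewrite mxE kj Normc.normc0 expr0n.
rewrite -(@ler_pXn2r _ 2) ?nnegrE ?opnorm_ge0//.
have <- : l2norm (udiag U d *m v) ^+ 2 = `|d j| ^+ 2.
  rewrite l2norm_udiag// v1 (bigD1 j)//= big1 ?addr0.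
    by rewrite mxE !eqxx Normc.normc1 expr1n mulr1 real_normK ?num_real.
  by move=> k /negPf kj; rewrite mxE kj Normc.normc0 expr0n mulr0.
rewrite -[leRHS]mulr1 -nv -exprMn lerXn2r ?nnegrE ?l2norm_mulmx//.
  exact: l2norm_ge0.
by rewrite mulr_ge0 ?opnorm_ge0 ?l2norm_ge0.
Qed.

(** [None] gives the zero matrix, so one formula also serves the indices at which there is no
    eigenvector left to choose. *)
Lemma rank_udiag_pred1 U (o : option 'I_m) :
  (\rank (udiag U (fun j => (o == Some j)%:R)) <= 1)%N.
Proof.
apply: leq_trans (mxrankM_maxl _ _) _; apply: leq_trans (mxrankM_maxr _ _) _.
case: o => [k|].
  rewrite (_ : diag_mx _ = delta_mx k k) ?mxrank_delta//.
  apply/matrixP => i j; rewrite !mxE.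
  have [->|ij] := eqVneq i j; last first.
    rewrite mulr0n; case: eqP => //= ik; rewrite -ik eq_sym (negPf ij).
    by rewrite mulr0n.
  by rewrite mulr1n andbb (inj_eq Some_inj) eq_sym rmorph_nat.
rewrite (_ : diag_mx _ = 0) ?mxrank0//.
by apply/matrixP => i j; rewrite !mxE mul0rn.
Qed.

Lemma hermitian_udiag (A : 'M[R[i]]_m) : A^t* = A ->
  exists U, exists d, U \is unitarymx /\ A = udiag U d.
Proof.
move=> AA; have hA : A \is hermsymmx.
  by apply/is_hermitianmxP; rewrite expr0 scale1r AA.
have /hermitian_normalmx/orthomx_spectralP eA := hA.
have V := invmx_unitary (spectral_unitarymx A).
(* The spectral values of a hermitian matrix are real, so they equal their real parts. *)
have hs : spectral_diag A = \row_j (complex.Re (spectral_diag A 0 j))%:C.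
  apply/rowP => j; rewrite mxE.
  have /mxOverP/(_ 0 j) := hermitian_spectral_diag_real hA.
  by move=> /RRe_real.
exists (spectralmx A), (fun j => complex.Re (spectral_diag A 0 j)).
split; first exact: spectral_unitarymx.
by rewrite /udiag -hs -V.
Qed.

Lemma char_poly_udiag U d : U \is unitarymx ->
  char_poly (udiag U d) = \prod_(j < m) ('X - ((d j)%:C)%:P).
Proof.
move=> UU.
transitivity (char_poly (D d)); last first.
  rewrite char_poly_trig ?diag_mx_is_trig//; apply: eq_bigr => j _.
  by rewrite !mxE eqxx mulr1n.
have UtU : U^t* *m U = 1%:M by rewrite -[LHS]mul1mx mulmxA mulmxKtV.
rewrite /char_poly.
have -> : char_poly_mx (udiag U d) =
    map_mx polyC (U^t*) *m char_poly_mx (D d) *m map_mx polyC U.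
  rewrite /char_poly_mx mulmxBr mulmxBl !map_mxM; congr (_ - _).
  by rewrite mul_mx_scalar -scalemxAl -map_mxM UtU map_mx1 scalemx1.
rewrite !det_mulmx mulrAC -det_mulmx -map_mxM UtU map_mx1 det1 mul1r//.
Qed.

(** The characteristic polynomial splits both over [eigenvalues] and over the entries of [d];
    uniqueness of the factorization makes the two lists permutations of each other. *)
Lemma N_udiag U d (M : set R) : U \is unitarymx ->
  N (udiag U d) M = #|[pred j | `[< M (d j) >]]|.
Proof.
move=> UU; rewrite /N.
have : perm_eq (eigenvalues (udiag U d)) [seq (d j)%:C | j <- enum 'I_m].
  apply: prod_XsubC_eq; rewrite big_map /index_enum /= big_enum/=.
  rewrite -(char_poly_udiag d UU) /eigenvalues.
  case: closed_field_poly_normal => /= s h.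
  by rewrite [RHS]h (monicP (char_poly_monic _)) scale1r.
move=> /permP ->; rewrite count_map cardE /enum_mem size_filter.
rewrite count_filter; apply: eq_count => j; rewrite !inE/= andbT.
apply/asboolP/asboolP => [[x Mx /complexI ->]//|Md].
by exists (d j).
Qed.

(** If there were more such indices than the rank of [K], the span of their eigenvectors would meet
    the kernel of [K] in some v different from 0. Then [udiag U d - K] sends v to a vector of norm
    at least [eps] times that of v. *)
Lemma card_udiag_le_rank U d (K : 'M[R[i]]_m) (eps : R) : U \is unitarymx ->
  opnorm (udiag U d - K) < eps ->
  (#|[pred j | (eps <= `|d j|)%R]| <= \rank K)%N.
Proof.
move=> UU AK; rewrite leqNgt; apply/negP; set J := [pred j | _] => rJ.
have e0 : 0 < eps by apply: le_lt_trans AK; exact: opnorm_ge0.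
(* A row c with c L = 0 is a coefficient vector on [J] whose combination of eigenvectors is killed
   by [K]. It exists because [L] has [#|J|] rows but rank at most that of [K]. *)
pose E : 'M[R[i]]_(#|J|, m) := rowsub enum_val 1%:M.
pose L := E *m (K *m U^t*)^T.
have : kermx L != 0.
  rewrite kermx_eq0 /row_free neq_ltn; apply/orP; left.
  apply: leq_ltn_trans rJ; apply: leq_trans (mxrankM_maxr _ _) _.
  by rewrite mxrank_tr mxrankM_maxl.
move=> /rowV0Pn[c /sub_kermxP cL c0]; pose w := (c *m E)^T.
have wJ j : j \notin J -> w j 0 = 0.
  move=> jJ; rewrite !mxE big1// => i _; rewrite !mxE.
  by case: eqP => [ij|]; [rewrite -ij enum_valP in jJ|rewrite mulr0].
have w0 : w != 0.
  apply: contra_neq c0 => w0; apply/rowP => i; rewrite mxE.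
  move/matrixP : w0 => /(_ (enum_val i) 0); rewrite !mxE => <-.
  rewrite (bigD1 i)//= !mxE eqxx mulr1 big1 ?addr0// => k ki.
  by rewrite !mxE (inj_eq enum_val_inj) (negPf ki) mulr0.
pose v := U^t* *m w.
have Uv : U *m v = w by rewrite mulmxA (unitarymxP _) ?mul1mx.
have Kv : K *m v = 0.
  by rewrite mulmxA -[LHS]trmxK trmx_mul trmxK -mulmxA cL trmx0.
have nv : 0 < l2norm v by rewrite -(l2norm_unitary v UU) Uv l2norm_gt0.
have := l2norm_mulmx (udiag U d - K) v; rewrite mulmxBl Kv subr0.
have lt_eps : opnorm (udiag U d - K) * l2norm v < eps * l2norm v.
  by rewrite ltr_pM2r.
move=> /le_lt_trans/(_ lt_eps); apply/negP; rewrite -leNgt.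
have ge0 : 0 <= eps * l2norm v by rewrite mulr_ge0 ?ltW.
rewrite (le_l2norm _ ge0) l2norm_udiag// exprMn -(l2norm_unitary v UU).
rewrite sqr_l2norm mulr_sumr.
apply: ler_sum => j _; rewrite Uv.
have [jJ|/wJ->] := boolP (j \in J); last by rewrite Normc.normc0 expr0n !mulr0.
rewrite ler_wpM2r ?sqr_ge0// -[leRHS]real_normK ?num_real//.
by rewrite lerXn2r ?nnegrE// ltW.
Qed.

(** This is |A v|^2 = <A^* A v, v>, expanded in the eigenbasis of A^* A. *)
Lemma sqr_l2norm_gram U d (A : 'M[R[i]]_m) (v : 'cV_m) :
  A^t* *m A = udiag U d ->
  l2norm (A *m v) ^+ 2 = \sum_j d j * Normc.normc ((U *m v) j 0) ^+ 2.
Proof.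
move=> AA; apply: complexI; rewrite sqr_l2normE trmx_mul map_mxM/=.
rewrite -mulmxA (mulmxA _ A) AA /udiag -!mulmxA (mulmxA (v^t*) (U^t*)).
rewrite -map_mxM -trmx_mul.
rewrite mul_diag_mx mxE rmorph_sum; apply: eq_bigr => j _; rewrite !mxE.
rewrite mulrCA rmorphM rmorphXn; congr (_ * _).
rewrite mulrC -normCK normc_def; case: (\sum_k _) => a b //.
Qed.

Lemma opnorm_sub_projection U d (A : 'M[R[i]]_m) (J : {set 'I_m}) (e : R) :
  U \is unitarymx -> A^t* *m A = udiag U d -> 0 <= e ->
  (forall j, j \notin J -> d j <= e ^+ 2) ->
  opnorm (A - A *m udiag U (fun j => (j \in J)%:R)) <= e.
Proof.
(* The difference is [A *m Q] with [Q] the complementary projection, which keeps only the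
   eigenvectors of A^* A with eigenvalue at most [e ^+ 2]. *)
move=> UU AA e0 dJ; pose Q := udiag U (fun j => (j \notin J)%:R).
have -> : A - A *m udiag U (fun j => (j \in J)%:R) = A *m Q.
  rewrite -[X in X - _](mulmx1 A) -mulmxBr -(udiag1 UU); congr mulmx.
  apply/eqP; rewrite subr_eq udiagD; apply/eqP; congr udiag.
  by apply/funext => j; case: (j \in J); rewrite ?add0r ?addr0.
apply: opnorm_le => // v.
rewrite l2norm_le ?mulr_ge0 ?l2norm_ge0// -mulmxA (sqr_l2norm_gram _ AA).
rewrite exprMn -(l2norm_unitary v UU) sqr_l2norm mulr_sumr ler_sum// => j _.
have -> : (U *m (Q *m v)) j 0 = ((j \notin J)%:R : R)%:C * (U *m v) j 0.
  rewrite /Q /udiag !mulmxA (unitarymxP _)// mul1mx -mulmxA mul_diag_mx.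
  by rewrite !mxE.
have [jJ|jJ] := boolP (j \in J).
  by rewrite mul0r Normc.normc0 expr0n mulr0 mulr_ge0 ?sqr_ge0.
by rewrite mul1r ler_wpM2r ?sqr_ge0// dJ.
Qed.

End UnitaryDiagonal.

(** * Bounded sequences and the ideal of compact sequences *)

Section Sequences.
Variables (R : realType) (delta : nat -> nat).
Implicit Types (A B K : mxseq R delta) (S J : set (mxseq R delta)).

Lemma opnorm_le_supnorm A n : F A -> opnorm (A n) <= supnorm A.
Proof.
by move=> [M AM]; apply: ub_le_sup; [exists M => _ [k _ <-]|exists n].
Qed.

Lemma supnorm_le A M : (forall n, opnorm (A n) <= M) -> supnorm A <= M.
Proof.
move=> AM; apply: ge_sup; first by exists (opnorm (A 0)), 0%N.
by move=> _ [n _ <-].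
Qed.

Lemma F_add A B : F A -> F B -> F (seqadd A B).
Proof.
move=> [M AM] [M' BM]; exists (M + M') => n.
by rewrite (le_trans (opnormD _ _))// lerD.
Qed.

Lemma F_sub A B : F A -> F B -> F (seqsub A B).
Proof.
move=> [M AM] [M' BM]; exists (M + M') => n.
by rewrite (le_trans (opnormD _ _))// opnormN lerD.
Qed.

Lemma F_mul A B : F A -> F B -> F (seqmul A B).
Proof.
move=> [M AM] [M' BM]; exists (M * M') => n.
by rewrite (le_trans (opnormM _ _))// ler_pM ?opnorm_ge0.
Qed.

Lemma F_bound A : F A -> exists2 M : R, 0 < M & forall n, opnorm (A n) <= M.
Proof.
move=> [M AM]; exists (M + 1) => [|n]; last by rewrite ler_wpDr.
by rewrite ltr_wpDl// (le_trans (opnorm_ge0 _) (AM 0%N)).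
Qed.

Lemma cstar_sub S A B : cstar_subalgebra S -> S A -> S B -> S (seqsub A B).
Proof.
move=> cS SA SB; rewrite (_ : seqsub A B = seqadd A (seqscale (-1) B)).
  by apply: csubD => //; exact: csubZ.
apply: functional_extensionality_dep => n.
by rewrite /seqadd /seqscale scaleN1r.
Qed.

Definition bounded_rank K : Prop := exists r, forall n, (\rank (K n) <= r)%N.

(** The concrete form of compactness: it is a closed ideal containing the generators, so minimality
    of [compact_seqs] gives every compact sequence such approximations. *)
Definition almost_bounded_rank : set (mxseq R delta) :=
  [set A | F A /\ forall e : R, 0 < e -> exists K,
    [/\ F K, bounded_rank K & forall n, opnorm (A n - K n) <= e]].

Lemma closed_ideal_almost_bounded_rank : closed_ideal almost_bounded_rank.
Proof.
have F0 : F (@seq0 R delta) by exists 0 => n; rewrite opnorm0.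
split.
- by move=> A [].
- split=> // e e0; exists (@seq0 R delta); split=> //.
    by exists 0%N => n; rewrite mxrank0.
  by move=> n; rewrite subr0 opnorm0 ltW.
- move=> A B [FA hA] [FB hB]; split=> [|e e0]; first exact: F_add.
  have [K [FK [r Kr] AK]] := hA _ (divr_gt0 e0 (ltr0Sn R 1)).
  have [L [FL [s Ls] BL]] := hB _ (divr_gt0 e0 (ltr0Sn R 1)).
  exists (seqadd K L); split=> [||n]; first exact: F_add.
    exists (r + s)%N => n; apply: leq_trans (mxrank_add _ _) _.
    by rewrite leq_add.
  rewrite [e]splitr /seqadd opprD addrACA.
  by rewrite (le_trans (opnormD _ _))// lerD.
- move=> A B FA [FB hB]; split=> [|e e0]; first exact: F_mul.
  have [M M0 AM] := F_bound FA.
  have [K [FK [r Kr] BK]] := hB _ (divr_gt0 e0 M0).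
  exists (seqmul A K); split=> [||n]; first exact: F_mul.
    by exists r => n; apply: leq_trans (mxrankM_maxr _ _) _.
  rewrite /seqmul -mulmxBr (le_trans (opnormM _ _))//.
  by rewrite -(divfK (lt0r_neq0 M0) e) mulrC ler_pM ?opnorm_ge0.
- move=> A B [FA hA] FB; split=> [|e e0]; first exact: F_mul.
  have [M M0 BM] := F_bound FB.
  have [K [FK [r Kr] AK]] := hA _ (divr_gt0 e0 M0).
  exists (seqmul K B); split=> [||n]; first exact: F_mul.
    by exists r => n; apply: leq_trans (mxrankM_maxl _ _) _.
  rewrite /seqmul -mulmxBl (le_trans (opnormM _ _))//.
  by rewrite -(divfK (lt0r_neq0 M0) e) ler_pM ?opnorm_ge0.
- move=> A FA hA; split=> // e e0.
  have [B [FB hB] AB] := hA _ (divr_gt0 e0 (ltr0Sn R 1)).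
  have [K [FK rK BK]] := hB _ (divr_gt0 e0 (ltr0Sn R 1)).
  exists K; split=> // n.
  rewrite [e]splitr -[A n](subrK (B n)) -addrA (le_trans (opnormD _ _))//.
  rewrite lerD// (le_trans _ (ltW AB))//.
  exact: (@opnorm_le_supnorm (seqsub A B) n (F_sub FA FB)).
Qed.

Lemma compact_seqs_almost_bounded_rank :
  @compact_seqs R delta `<=` almost_bounded_rank.
Proof.
apply: smallest_sub; first exact: closed_ideal_almost_bounded_rank.
move=> K [FK K1]; split=> // e e0; exists K; split=> [//||n].
  by exists 1%N.
by rewrite subrr opnorm0 ltW.
Qed.

(** [compact_seqs] is an intersection of closed ideals, and the clauses pass to intersections.
    Boundedness is read off one member of the family, [almost_bounded_rank]. *)
Lemma closed_ideal_compact_seqs : closed_ideal (@compact_seqs R delta).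
Proof.
split.
- by move=> A /compact_seqs_almost_bounded_rank[].
- by move=> J [[]].
- by move=> A B cA cB J JJ; apply: (cidealD JJ.1); [apply: cA|apply: cB].
- by move=> A B FA cB J JJ; apply: (cidealMl JJ.1) => //; apply: cB.
- by move=> A B cA FB J JJ; apply: (cidealMr JJ.1) => //; apply: cA.
- move=> A FA hA J JJ; apply: (cideal_closed JJ.1) => // e /hA[B cB AB].
  by exists B => //; apply: cB.
Qed.

(** * Sequences diagonalized by a common sequence of unitaries *)

Section Diagonalized.
Variable U : forall n, 'M[R[i]]_(delta n).
Hypothesis unitaryU : forall n, U n \is unitarymx.
Implicit Types d f g : forall n, 'I_(delta n) -> R.

Definition useq d : mxseq R delta := fun n => udiag (U n) (@d n).

Lemma seqmul_useq f g :
  seqmul (useq f) (useq g) = useq (fun n j => f n j * g n j).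
Proof.
by apply: functional_extensionality_dep => n; rewrite /seqmul udiagM.
Qed.

Lemma F_useq d (M : R) : 0 <= M -> (forall n j, `|d n j| <= M) -> F (useq d).
Proof. by move=> M0 dM; exists M => n; apply: opnorm_udiag_le. Qed.

(** Induction on [r]: one rank-one projection is split off simultaneously at all n, which leaves
    sets with at most [r - 1] elements. *)
Lemma compact_projection (r : nat) (J : forall n, {set 'I_(delta n)}) :
  (forall n, #|J n| <= r)%N ->
  compact_seqs (useq (fun n j => (j \in J n)%:R)).
Proof.
have [_ c0 cD _ _ _] := closed_ideal_compact_seqs.
elim: r J => [|r IHr] J Jr.
  rewrite (_ : useq _ = @seq0 R delta)//.
  apply: functional_extensionality_dep => n; rewrite /useq.
  have /eqP : #|J n| == 0%N by rewrite -leqn0.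
  move=> /cards0_eq ->; rewrite /udiag (_ : diag_mx _ = 0) ?mulmx0 ?mul0mx//.
  by apply/matrixP => i j; rewrite !mxE inE mul0rn.
(* When [J n] is empty, [o n] is [None]: the split-off term is zero there and [J' n] stays empty. *)
pose o n := [pick j in J n].
pose J' n := if o n is Some k then J n :\ k else J n.
pose P : mxseq R delta := useq (fun n j => (o n == Some j)%:R).
have PE : useq (fun n j => (j \in J n)%:R) =
    seqadd P (useq (fun n j => (j \in J' n)%:R)).
  apply: functional_extensionality_dep => n.
  rewrite /seqadd /useq udiagD; congr udiag; apply/funext => j.
  rewrite /J' /o; case: pickP => [k kJ|/(_ j) Jj]; last first.
    by rewrite add0r.
  rewrite !inE (inj_eq Some_inj) eq_sym.
  by have [->|jk] := eqVneq j k; rewrite ?kJ ?addr0 ?add0r.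
rewrite PE; apply: cD.
  apply: sub_gen_smallest; split; last by move=> n; exact: rank_udiag_pred1.
  by apply: (@F_useq _ 1) => // n j; case: eqP => _; rewrite ?normr1 ?normr0.
apply: IHr => n; rewrite /J' /o; case: pickP => [k kJ|/(_ _) Jn].
  by move: (Jr n); rewrite (cardsD1 k) kJ.
by rewrite eq_card0.
Qed.

(** The bound is uniform, but agreement with [K] is required only at the n in question; this is what
    makes it usable along a subsequence. It is the rank of an approximation of [K] within [eps / 2],
    half of [eps] giving the strict inequality. *)
Lemma card_compact_useq d K (eps : R) : 0 < eps -> compact_seqs K ->
  exists r, forall n, useq d n = K n ->
    (#|[pred j | (eps <= `|d n j|)%R]| <= r)%N.
Proof.
move=> e0 /compact_seqs_almost_bounded_rank.
move=> [_ /(_ _ (divr_gt0 e0 (ltr0Sn R 1)))].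
move=> [L [_ [r Lr] KL]]; exists r => n dK; apply: leq_trans (Lr n).
apply: card_udiag_le_rank => //; rewrite -/(useq d n) dK.
by apply: le_lt_trans (KL n) _; rewrite ltr_pdivrMr// ltr_pMr// ltr1n.
Qed.

(** * Real functional calculus inside a unital C*-subalgebra *)

Section FunctionalCalculus.
Variable S : set (mxseq R delta).
Hypotheses (cS : cstar_subalgebra S) (S1 : S (@seq1 R delta)).

Lemma useqD_mem f g :
  S (useq f) -> S (useq g) -> S (useq (fun n j => f n j + g n j)).
Proof.
move=> Sf Sg; rewrite (_ : useq _ = seqadd (useq f) (useq g)).
  exact: csubD.
by apply: functional_extensionality_dep => n; rewrite /seqadd udiagD.
Qed.

Lemma useqM_mem f g :
  S (useq f) -> S (useq g) -> S (useq (fun n j => f n j * g n j)).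
Proof. by move=> Sf Sg; rewrite -seqmul_useq; exact: csubM. Qed.

Lemma useqZ_mem (c : R) f : S (useq f) -> S (useq (fun n j => c * f n j)).
Proof.
move=> Sf; rewrite (_ : useq _ = seqscale c%:C (useq f)).
  exact: csubZ.
by apply: functional_extensionality_dep => n; rewrite /seqscale udiagZ.
Qed.

Lemma useqC_mem (c : R) : S (useq (fun n j => c)).
Proof.
rewrite (_ : useq _ = useq (fun n j => c * 1)); last first.
  by apply: functional_extensionality_dep => n; rewrite mulr1.
apply: useqZ_mem; rewrite (_ : useq _ = @seq1 R delta)//.
by apply: functional_extensionality_dep => n; exact: udiag1.
Qed.

(** The rate [2 / k.+2%:R] is the one at which [abs_approx] converges. *)
Lemma useq_lim_mem f (g : nat -> forall n, 'I_(delta n) -> R) :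
  F (useq f) -> (forall k, S (useq (g k))) ->
  (forall k n j, `|f n j - g k n j| <= 2 / k.+2%:R) -> S (useq f).
Proof.
move=> Ff Sg fg; apply: (csub_closed cS) => // e e0.
pose k := Num.bound (2 / e).
exists (useq (g k)) => //; apply: (@le_lt_trans _ _ (2 / k.+2%:R)).
  apply: supnorm_le => n.
  rewrite (_ : seqsub _ _ _ = udiag (U n) (fun j => f n j + -1 * g k n j)).
    by apply: opnorm_udiag_le => // j; rewrite mulN1r.
  by rewrite /seqsub -udiagD -udiagZ rmorphN1 scaleN1r.
rewrite ltr_pdivrMr// mulrC -ltr_pdivrMr//.
have := archi_boundP (ltW (divr_gt0 (ltr0Sn R 1) e0)).
by move=> /lt_le_trans; apply; rewrite ler_nat /k ltnW.
Qed.

(** The classical iteration for the square root of [x ^+ 2]. Its terms are polynomials in [x], hence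
    stay in the algebra, and they converge to [|x|] uniformly on [-1, 1]. *)
Fixpoint abs_approx (x : R) (k : nat) : R :=
  if k is k'.+1 then
    abs_approx x k' + 2^-1 * (x ^+ 2 - abs_approx x k' ^+ 2)
  else 0.

(* The error [e k] satisfies [0 <= e k <= |x|] and
   [e k.+1 = e k * (1 - |x| + e k / 2) <= e k - e k ^+ 2 / 2]. *)
Lemma abs_approxP x k : `|x| <= 1 ->
  0 <= abs_approx x k <= `|x| /\ `|x| - abs_approx x k <= 2 / k.+2%:R.
Proof.
move=> x1; have x0 := normr_ge0 x; elim: k => [|k [/andP[IH0 IH1] IH2]] /=.
  by rewrite lexx x0 subr0 divff.
rewrite -[x ^+ 2]real_normK ?num_real//.
move: (abs_approx x k) (`|x|) x0 x1 IH0 IH1 IH2 => q y y0 y1 q0 qy IH.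
split; first by apply/andP; split; nra.
have K0 : 0 < k.+2%:R :> R by [].
have E : k.+3%:R = k.+2%:R + 1 :> R by rewrite -natr1.
move: IH; rewrite !ler_pdivlMr// E; move: (k.+2%:R) K0 E => t t0 _ IH.
set z := y - q in IH.
(* The left side is [z * t * (1 - z / 2) + z - z ^+ 2 / 2]; since [z * t <= 2], it is at most
   [2 - z ^+ 2 / 2]. *)
have : (z - 2^-1 * z ^+ 2) * (t + 1) <= 2.
  have z0 : 0 <= z by rewrite subr_ge0.
  have z1 : z <= 1 by rewrite lerBlDr; nra.
  nra.
apply: le_trans; rewrite ler_pM2r; last by rewrite addr_gt0.
by rewrite /z; nra.
Qed.

Lemma useq_abs_mem f : S (useq f) -> S (useq (fun n j => `|f n j|)).
Proof.
move=> Sf; have [M M0 fM] := F_bound (csub_bounded cS Sf).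
have fM' n j : `|f n j| <= M by exact: le_trans (le_opnorm_udiag _ _ _) (fM n).
(* Dividing by the bound [M] moves the eigenvalues into [-1, 1], where [abs_approx] converges. *)
rewrite (_ : useq _ = useq (fun n j => M * `|M^-1 * f n j|)); last first.
  apply: functional_extensionality_dep => n; congr udiag; apply/funext => j.
  by rewrite normrM gtr0_norm ?invr_gt0// mulVKf// gt_eqF.
apply: useqZ_mem.
have f1 n j : `|M^-1 * f n j| <= 1.
  by rewrite normrM gtr0_norm ?invr_gt0// mulrC ler_pdivrMr// mul1r.
apply: (@useq_lim_mem _ (fun k n j => abs_approx (M^-1 * f n j) k)).
- by apply: (@F_useq _ 1) => // n j; rewrite normr_id.
- elim=> [|k IH] /=; first exact: useqC_mem.
  apply: (useqD_mem IH); apply: useqZ_mem; apply: useqD_mem.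
    by apply: useqM_mem; exact: useqZ_mem.
  rewrite (_ : useq _ = useq (fun n j => -1 *
    (abs_approx (M^-1 * f n j) k * abs_approx (M^-1 * f n j) k))).
    by apply: useqZ_mem; exact: useqM_mem.
  apply: functional_extensionality_dep => n; congr udiag; apply/funext => j.
  by rewrite mulN1r.
- move=> k n j; have [/andP[_ le] ?] := abs_approxP k (f1 n j).
  by rewrite ger0_norm// subr_ge0.
Qed.

End FunctionalCalculus.
End Diagonalized.

End Sequences.

(** * Essential fractality as a lifting property of compactness *)

Section EssentialFractality.
Variables (R : realType) (delta : nat -> nat) (S : set (mxseq R delta)).
Hypothesis cS : cstar_subalgebra S.
Implicit Types A K : mxseq R delta.

(** Forward, the second clause yields a compact B in [S] with the restriction of [A], and fractality
    puts [A] in the coset of B. Backward, elements of [S] with equal restrictions differ by a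
    sequence restricting to 0, which is compact by the case [K = 0]. *)
Lemma essentially_fractalP : essentially_fractal S <->
  forall eta, strictly_increasing eta -> forall A K, S A -> compact_seqs K ->
    restr eta A = restr eta K -> compact_seqs A.
Proof.
have [_ c0 cD _ _ _] := @closed_ideal_compact_seqs R delta.
have S0 := csub0 cS.
have addr0s A : seqadd A (@seq0 R delta) = A.
  by apply: functional_extensionality_dep => n; rewrite /seqadd addr0.
have SJ0 : (S `&` @compact_seqs R delta) (@seq0 R delta) by [].
split=> [[frac comp] eta incr A K SA cK AK|comp].
  have [B [SB cB] BA] : [set restr eta B | B in S `&` @compact_seqs R delta]
      (restr eta A).
    by rewrite comp//; split; [exists A|exists K].
  have [W_ eW] := frac _ incr.
  have : coset_map (S `&` @compact_seqs R delta) A A by exists (@seq0 R delta).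
  rewrite eW// -BA -eW// => -[C [SC cC'] <-]; exact: cD.
split=> [eta incr|eta incr].
  pose P X A := S A /\ restr eta A = X.
  (* Any preimage in [S] is chosen; [set0] is a default value outside the restriction of [S]. *)
  exists (fun X => if pselect (exists A, P X A) is left h then
    coset_map (S `&` @compact_seqs R delta) (sval (cid h)) else set0).
  move=> A SA; case: pselect => [h|[]]; last by exists A.
  case: cid => B /= [SB BA].
  have cAB A1 A2 : S A1 -> S A2 -> restr eta A1 = restr eta A2 ->
      compact_seqs (seqsub A1 A2).
    move=> S1 S2 e12; apply: (comp _ incr _ (@seq0 R delta)) => //.
      exact: cstar_sub.
    apply: functional_extensionality_dep => n.
    have /(congr1 (fun X : mxseq R (delta \o eta) => X n)) := e12.
    by rewrite /restr /seqsub => ->; rewrite subrr.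
  have sub A1 A2 : S A1 -> S A2 -> restr eta A1 = restr eta A2 ->
      coset_map (S `&` @compact_seqs R delta) A1 `<=`
      coset_map (S `&` @compact_seqs R delta) A2.
    move=> S1 S2 e12 _ [K [SK cK] <-].
    exists (seqadd (seqsub A1 A2) K).
      split; first by apply: csubD => //; exact: cstar_sub.
      by apply: cD => //; exact: cAB.
    apply: functional_extensionality_dep => n.
    by rewrite /seqadd /seqsub addrA (addrC (A2 n)) subrK.
  by apply/seteqP; split; apply: sub.
apply/seteqP; split=> [X [A [SA cA] <-]|X [[A SA <-] [K cK AK]]].
  by split; exists A.
by exists A => //; split=> //; apply: (comp _ incr _ K).
Qed.

End EssentialFractality.

(** * Arveson dichotomy and the two implications *)

Section Dichotomy.
Variables (R : realType) (delta : nat -> nat).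
Implicit Types A B K : mxseq R delta.

Lemma selfadjoint_useq A : selfadjoint A ->
  exists U, exists d, (forall n, U n \is unitarymx) /\ A = useq U d.
Proof.
move=> AA; have h n : exists U, exists d, U \is unitarymx /\ A n = udiag U d.
  apply: hermitian_udiag.
  by move/(congr1 (fun X : mxseq R delta => X n)) : AA.
exists (fun n => sval (cid (h n))), (fun n => sval (cid (svalP (cid (h n))))).
split=> [n|]; first by case: (svalP (cid (svalP (cid (h n))))).
apply: functional_extensionality_dep => n.
by case: (svalP (cid (svalP (cid (h n))))).
Qed.

Lemma open_interval_atP (x : R) (V : set R) : open_interval_at x V ->
  exists2 r : R, 0 < r & forall y, `|y - x| < r -> V y.
Proof.
move=> [oV _ Vx]; have /nbhs_ballP[r /= r0 rV] := open_nbhs_nbhs (conj oV Vx).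
by exists r => // y yx; apply: rV; rewrite /ball/= distrC.
Qed.

Lemma not_essential A x : ~ essential A x -> exists V M (eta : nat -> nat),
  [/\ open_interval_at x V, strictly_increasing eta &
      forall n, (N (A (eta n)) V < M)%N].
Proof.
move=> /existsNP[V /not_implyP[xV]].
move=> /cvgnyPge/existsNP[M hM]; exists V, M.
have h k : exists n, (k < n)%N /\ (N (A n) V < M)%N.
  apply: contrapT => /forallNP hn; apply: hM; exists k.+1 => // n /= kn.
  by rewrite leqNgt; apply/negP => nM; apply: (hn n).
have [g gP] := choice h.
(* Iteration starts with one application of [g], since only values of [g] are known to have few
   eigenvalues in [V]. *)
exists (fun n => iter n.+1 g 0%N); split=> // [|n].
  apply: homo_ltn => [? ? ?|n]; first exact: ltn_trans.
  by case: (gP (iter n.+1 g 0%N)).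
by case: (gP (iter n g 0%N)).
Qed.

Section Equivalence.
Variable S : set (mxseq R delta).
Hypotheses (cS : cstar_subalgebra S) (S1 : S (@seq1 R delta)).

Lemma essentially_fractal_dichotomy : essentially_fractal S ->
  forall A, S A -> selfadjoint A -> arveson_dichotomy A.
Proof.
move=> /(essentially_fractalP cS) comp A SA /selfadjoint_useq[U [d [UU Ad]]] x.
have [|/not_essential[V [M [eta [xV incr NM]]]]] := pselect (essential A x).
  by left.
have [r r0 rV] := open_interval_atP xV; right.
(* [b] is the positive part of [r ^+ 2 - (t - x) ^+ 2] at the eigenvalues. *)
pose g n j := r ^+ 2 + -1 * ((d n j + - x) * (d n j + - x)).
pose b n j := 2^-1 * (g n j + `|g n j|).
have gE n j : g n j = r ^+ 2 - (d n j - x) ^+ 2 by rewrite /g mulN1r.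
have Sb : S (useq U b).
  have Sd : S (useq U d) by rewrite -Ad.
  have Sx := useqD_mem cS Sd (useqC_mem UU cS S1 (- x)).
  have Sxx := useqZ_mem cS (-1) (useqM_mem UU cS Sx Sx).
  have Sg := useqD_mem cS (useqC_mem UU cS S1 (r ^+ 2)) Sxx.
  exact: (useqZ_mem cS 2^-1 (useqD_mem cS Sg (useq_abs_mem UU cS S1 Sg))).
have bV n j : b n j != 0 -> V (d n j).
  move=> b0; apply: rV; rewrite -(@ltr_pXn2r _ 2) ?nnegrE ?(ltW r0)//.
  rewrite real_normK ?num_real// -subr_gt0 -gE ltNge.
  apply: contra b0 => g0.
  by rewrite /b ler0_norm// subrr mulr0.
pose J n := [set j | b n j != 0]%SET.
(* Cutting the support down to the range of [eta] bounds its size at every n. The product of [b]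
   with this projection is compact and agrees with [b] along [eta]. *)
pose J' n := if `[< exists k, n = eta k >] then J n else finset.set0.
have J'M n : (#|J' n| <= M)%N.
  rewrite /J'; case: asboolP => [[k ->]|]; last by rewrite cards0.
  apply: leq_trans (ltnW (NM k)); rewrite Ad N_udiag//.
  by apply: subset_leq_card; apply/fintype.subsetP => j; rewrite !inE => /bV.
have [_ _ _ cMl _ _] := @closed_ideal_compact_seqs R delta.
have cK := cMl _ _ (csub_bounded cS Sb) (compact_projection UU J'M).
have cb : compact_seqs (useq U b).
  apply: (comp _ incr _ _ Sb cK); rewrite (seqmul_useq UU).
  apply: functional_extensionality_dep => n; rewrite /restr /useq.
  congr udiag; apply/funext => j.
  rewrite /J'; case: asboolP => [_|[]]; last by exists n.
  by rewrite inE; case: eqP => [->|_]; rewrite ?mul0r ?mulr1.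
(* Where |t - x| < r / 2, the bump is at least 3 r^2 / 4, so these eigenvalues are all counted at
   the threshold [r ^+ 2 / 2]. *)
have r2 : 0 < r ^+ 2 / 2 by rewrite divr_gt0 ?exprn_gt0.
have [m mP] := card_compact_useq UU b r2 cb.
exists `]x - r / 2, x + r / 2[%classic.
  split; [exact: itv_open|exact: interval_is_interval|].
  by rewrite /= in_itv/= ltrBlDr !ltrDl divr_gt0.
exists m => n; apply: leq_trans (mP n erefl); rewrite Ad N_udiag//.
apply: subset_leq_card; apply/fintype.subsetP => j; rewrite !inE.
rewrite /= in_itv/= => /andP[d1 d2].
have g1 : r ^+ 2 / 2 <= g n j by rewrite gE; nra.
have g0 : 0 <= g n j by apply: le_trans g1; exact: ltW.
by rewrite /b (ger0_norm g0) ger0_norm; lra.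
Qed.

Lemma card_le_sum_cover (m : nat) (d : 'I_m -> R) (P : {set 'I_m})
    (V : R -> set R) (s : seq R) :
  (forall j, j \in P -> exists2 y, y \in s & V y (d j)) ->
  (#|P| <= \sum_(y <- s) #|[pred j | `[< V y (d j) >]]|)%N.
Proof.
move=> hP; rewrite -sum1_card.
under [leqRHS]eq_bigr do rewrite -sum1_card big_mkcond/=.
rewrite exchange_big/= big_mkcond/=; apply: leq_sum => j _.
case: ifP => // /hP[y ys Vy]; rewrite (big_rem y)//= !inE.
by rewrite asboolT.
Qed.

Lemma dichotomy_essentially_fractal :
  (forall A, S A -> selfadjoint A -> arveson_dichotomy A) ->
  essentially_fractal S.
Proof.
move=> dich; apply/(essentially_fractalP cS) => eta incr A K SA cK AK.
have [_ _ _ cMl _ cC] := @closed_ideal_compact_seqs R delta.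
have SAA : S (seqadj A) by exact: csub_adj.
pose B := seqmul (seqadj A) A.
have SB : S B by exact: csubM.
have BB : selfadjoint B.
  apply: functional_extensionality_dep => n.
  by rewrite /seqadj /B /seqmul /seqadj trmx_mul map_mxM/= trmxCK.
have cK' := cMl _ _ (csub_bounded cS SAA) cK.
have BK n : B (eta n) = seqmul (seqadj A) K (eta n).
  move/(congr1 (fun X : mxseq R (delta \o eta) => X n)) : AK.
  by rewrite /restr /B /seqmul => ->.
have [U [d [UU Bd]]] := selfadjoint_useq BB.
have le_eta n : (n <= eta n)%N.
  by elim: n => // n IHn; apply: leq_ltn_trans IHn _; exact: incr.
(* Along [eta], [B] equals the compact sequence A^* K, so its number of eigenvalues above [y / 2] is
   bounded there, which rules out that y is essential. *)
have trans (y : R) : 0 < y -> transient B y.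
  move=> y0; have y20 : 0 < y / 2 by rewrite divr_gt0.
  have [ess|//] := dich _ SB BB y.
  have oU : open_interval_at y `]y / 2, +oo[%classic.
    split; [exact: rray_open|exact: interval_is_interval|].
    by rewrite /= in_itv/= andbT ltr_pdivrMr// ltr_pMr// ltr1n.
  have [r rP] := card_compact_useq UU d y20 cK'.
  have /cvgnyPge/(_ r.+1)[n0 _ n0P] := ess _ oU.
  have := n0P _ (le_eta n0); rewrite /= ltnNge => /negP[].
  have dK : useq U d (eta n0) = seqmul (seqadj A) K (eta n0).
    by rewrite -Bd BK.
  apply: leq_trans (rP _ dK); rewrite Bd N_udiag//.
  apply: subset_leq_card; apply/fintype.subsetP => j; rewrite !inE.
  rewrite /= in_itv/= andbT => yd.
  exact: le_trans (ltW yd) (ler_norm _).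
have [M M0 BM] := F_bound (csub_bounded cS SB).
have dM n j : d n j <= M.
  apply: le_trans (ler_norm _) _; apply: le_trans (BM n).
  by rewrite Bd; exact: le_opnorm_udiag.
have cardJ (eps : R) : 0 < eps -> exists r, forall n,
    (#|[set j | (eps < d n j)%R]%SET| <= r)%N.
  (* Positivity of y sits inside the existential so that [choice] yields functions on all of [R]. *)
  move=> e0; have hV (y : R) : exists V : set R, 0 < y ->
      open_interval_at y V /\ exists m, forall n, (N (B n) V <= m)%N.
    have [y0|] := boolP (0 < y); last by exists set0.
    by have [V yV VM] := trans y y0; exists V.
  have [V VP] := choice hV.
  have hm (y : R) : exists m, 0 < y -> forall n, (N (B n) (V y) <= m)%N.
    have [/VP[_ [k kP]]|] := boolP (0 < y); last by exists 0%N.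
    by exists k.
  have [m mP] := choice hm.
  have pos (y : R) : y \in `[eps, M] -> 0 < y.
    by rewrite in_itv/= => /andP[+ _]; exact: lt_le_trans.
  (* Finitely many intervals [V y] cover [[eps, M]], which contains every eigenvalue above [eps];
     their bounds [m y] add up to a bound for all n. *)
  have := @segment_compact R eps M; rewrite compact_cover.
  move=> /(_ R `[eps, M]%classic V) [y /pos/VP[[]]//|y ey|D DI DV].
    by exists y => //; have /VP[[]] := pos _ ey.
  exists (\sum_(y <- finmap.enum_fset D) m y)%N => n.
  apply: leq_trans (@card_le_sum_cover _ (@d n) _ V (finmap.enum_fset D) _) _.
    move=> j; rewrite inE => ej.
    have [|y Dy Vy] := DV (d n j); first by rewrite /= in_itv/= (ltW ej) dM.
    by exists y.
  rewrite [leqLHS]big_seq [leqRHS]big_seq; apply: leq_sum => y yD.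
  have y0 : 0 < y by apply: pos; have := DI _ yD; rewrite inE.
  by have := mP y y0 n; rewrite Bd N_udiag.
have FA := csub_bounded cS SA.
apply: cC => // e e0.
have e20 : 0 < e / 2 by rewrite divr_gt0.
have [r rP] := cardJ _ (exprn_gt0 2 e20).
have cP := compact_projection UU rP.
(* The [d n j] are squared singular values, hence the threshold [(e / 2) ^+ 2]; the error is then at
   most [e / 2], strictly below [e]. *)
exists (seqmul A (useq U (fun n j =>
  (j \in [set j | ((e / 2) ^+ 2 < d n j)%R]%SET)%:R))); first exact: cMl.
have lt_e : e / 2 < e by rewrite ltr_pdivrMr// ltr_pMr// ltr1n.
apply: le_lt_trans lt_e; apply: supnorm_le => n.
apply: (@opnorm_sub_projection _ _ _ (@d n)) => //.
- by move/(congr1 (fun X : mxseq R delta => X n)) : Bd.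
- exact: ltW.
- by move=> j; rewrite inE -leNgt.
Qed.

End Equivalence.
End Dichotomy.

Theorem theorem30 (R : realType) (delta : nat -> nat)
  (delta_gt0 : forall n : nat, (0 < delta n)%N)
  (S : set (mxseq R delta)) (S_cstar : cstar_subalgebra S)
  (S_unital : S (seq1 R delta)) :
  essentially_fractal S <->
  (forall A : mxseq R delta, S A -> selfadjoint A -> arveson_dichotomy A).
Proof.
split; first exact: essentially_fractal_dichotomy.
exact: dichotomy_essentially_fractal.
Qed.
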